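(* Problem (PLinfd) is normal: whenever $(x^{[i]},y^{[i]},v^{[i]})_{i=1}^N$ solves (PLinfd), with $y^{[i]}\equiv\alpha^{[i]}>0$ for $i=1,\ldots,N$, and $\lambda_0\ge0$, $\lambda^{[i]}\in W^{1,\infty}(0,1;\mathbb{R}^n)$, $\mu^{[i]}\in W^{1,\infty}(0,1;\mathbb{R})$, $i=1,\ldots,N$, are multipliers satisfying the maximum-principle conditions (a)–(e) listed in the context, one has $\lambda_0>0$. Subsequently, one can set $\lambda_0=1$ for Problem (PLinfd) (after rescaling the multipliers).
   Context: Let $t_0<t_1<\cdots<t_N=:t_f$, $\tau_i:=t_i-t_{i-1}$, and let $z_0,\ldots,z_N\in\mathbb{R}^n$ with $z_i\ne z_{i-1}$, $i=1,\ldots,N$. Let $f:\mathbb{R}^n\times[t_0,t_f]\to\mathbb{R}^n$ be continuous and continuously differentiable in its first argument, and write $f^{[i]}(x,s):=f(x,t_{i-1}+s\tau_i)$. Problem (PLinfd): minimize $\sum_{i=1}^N\tau_i\int_0^1 y^{[i]}(s)\,ds$ over $x^{[i]}\in W^{1,\infty}(0,1;\mathbb{R}^n)$, $y^{[i]}\in W^{1,\infty}(0,1;\mathbb{R})$, $v^{[i]}\in L^\infty(0,1;\mathbb{R}^n)$ subject to $\dot x^{[i]}(s)=\tau_i\big(f^{[i]}(x^{[i]}(s),s)+y^{[i]}(s)v^{[i]}(s)\big)$ a.e. $s\in[0,1]$, $x^{[i]}(0)=z_{i-1}$, $x^{[i]}(1)=z_i$, $\dot y^{[i]}(s)=0$ for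 all $s\in[0,1]$, and $|v^{[i]}_j(s)|\le1$ a.e. $s\in[0,1]$, for $i=1,\ldots,N$, $j=1,\ldots,n$. Here $y^{[i]}$ is the constant $\alpha^{[i]}\ge0$ representing a bound on the residual in stage $i$. Hamiltonian of stage $i$: $H^{[i]}(x,y,\lambda_0,\lambda,\mu,v,s)=\tau_i\big(\lambda_0\,y+\lambda^T(f^{[i]}(x,s)+y\,v)+\mu\cdot0\big)$. Maximum-principle conditions on the multipliers (partial derivatives evaluated along $(x^{[i]}(s),y^{[i]}(s),\lambda_0,\lambda^{[i]}(s),\mu^{[i]}(s),v^{[i]}(s),s)$): (a) $(\lambda_0,\lambda^{[i]}(s),\mu^{[i]}(s))\ne0$ for every $s\in[0,1]$, $i=1,\ldots,N$; (b) $\dot\lambda^{[i]}_j(s)=-\partial H^{[i]}/\partial x_j$ for a.e. $s\in[0,1]$, $j=1,\ldots,n$; (c) $\lambda^{[i+1]}_j(0)=\lambda^{[i]}_j(1)+\delta^{[i]}_j$ for some real constants $\delta^{[i]}_j$, $i=1,\ldots,N-1$ (jumps are allowed); (d) $\dot\mu^{[i]}(s)=-\partial H^{[i]}/\partial y$ for a.e. $s\in[0,1]$, and $\mu^{[i]}(0)=0=\mu^{[i]}(1)$; (e) $v^{[i]}(s)\in\operatorname{argmin}\{H^{[i]}(x^{[i]}(s),y^{[i]}(s),\lambda_0,\lambda^{[i]}(s),\mu^{[i]}(s),w,s): w\in\mathbb{R}^n,\ |w_j|\le1,\ j=1,\ldots,n\}$ for a.e. $s\in[0,1]$. The problem is called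 normal if $\lambda_0>0$ and abnormal if $\lambda_0=0$. *)

(* Defs.v *)
From HB Require Import structures.
From mathcomp Require Import all_boot all_order all_algebra.
From mathcomp Require Import all_classical all_reals all_analysis.

Set Implicit Arguments.
Unset Strict Implicit.
Unset Printing Implicit Defensive.

Import Order.TTheory GRing.Theory Num.Theory.
Import numFieldNormedType.Exports.

Local Open Scope classical_set_scope.
Local Open Scope ring_scope.

(* Functions on the unit interval are functions on R of which only the values
   on [0, 1] are ever used. *)

Definition ae01 (R : realType) (P : R -> Prop) : Prop :=
  {ae @lebesgue_measure R, forall s : R, 0 <= s <= 1 -> P s}.

(* Derivative relative to [0, 1]: the usual derivative at interior points, the
   one-sided one at 0 and 1. *)
Definition has_deriv01 (R : realType) (V : normedModType R)
    (u : R -> V) (s : R) (d : V) : Prop :=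
  (fun r => (r - s)^-1 *: (u r - u s)) @ within `[0, 1] s^' --> d.

(* L^oo(0, 1): [g \_ `[0, 1]] extends g by 0 outside [0, 1].  Measurability is
   with respect to the Borel sets; every class has a Borel representative. *)
Definition Loo01 (R : realType) (g : R -> R) : Prop :=
  (g \_ `[0, 1] : measurableTypeR R -> R) \in Lfun (@lebesgue_measure R) +oo%E.

Definition abs_cont01 (R : realType) (u : R -> R) : Prop :=
  forall e : R, 0 < e -> exists2 d : R, 0 < d &
    forall (m : nat) (a b : 'I_m -> R),
      (forall k, 0 <= a k /\ a k <= b k /\ b k <= 1) ->
      trivIset setT (fun k => `]a k, b k[%classic) ->
      \sum_k (b k - a k) < d ->
      \sum_k `|u (b k) - u (a k)| < e.

(* W^{1,oo}(0, 1): absolutely continuous functions with derivative in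
   L^oo(0, 1). *)
Definition W1oo (R : realType) (u : R -> R) : Prop :=
  abs_cont01 u /\
  exists2 g : R -> R, Loo01 g & ae01 (fun s => has_deriv01 u s (g s)).

Definition Loo01_vec (R : realType) (n : nat) (v : R -> 'rV[R]_n) : Prop :=
  forall j, Loo01 (fun s => v s 0 j).

Definition W1oo_vec (R : realType) (n : nat) (x : R -> 'rV[R]_n) : Prop :=
  forall j, W1oo (fun s => x s 0 j).

Definition argmin (R : realType) (T : Type) (h : T -> R) (A : set T) : set T :=
  [set w | A w /\ forall w', A w' -> h w <= h w'].

Definition cube (R : realType) (n : nat) : set 'rV[R]_n :=
  [set w | forall j, `|w 0 j| <= 1].

(* The stages are indexed from 0: stage i : 'I_N runs from the node
   [lnode i] = i to the node [rnode i] = i + 1. *)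
Definition lnode (N : nat) (i : 'I_N) : 'I_N.+1 := widen_ord (leqnSn N) i.
Definition rnode (N : nat) (i : 'I_N) : 'I_N.+1 := lift ord0 i.

Definition tau (R : realType) (N : nat) (t : 'I_N.+1 -> R) (i : 'I_N) : R :=
  t (rnode i) - t (lnode i).

Definition fstage (R : realType) (n N : nat) (t : 'I_N.+1 -> R)
    (f : 'rV[R]_n -> R -> 'rV[R]_n) (i : 'I_N) (x : 'rV[R]_n) (s : R) :
    'rV[R]_n :=
  f x (t (lnode i) + s * tau t i).

(* f is only constrained on R^n x [a, b]. *)
Definition continuous_C1_fst (R : realType) (n : nat) (a b : R)
    (f : 'rV[R]_n -> R -> 'rV[R]_n) : Prop :=
  {within [set p : 'rV[R]_n * R | a <= p.2 <= b],
     continuous (fun p : 'rV[R]_n * R => f p.1 p.2)} /\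
  (forall r : R, a <= r <= b ->
     (forall x, differentiable (f^~ r) x) /\
     (forall j, continuous (fun x => 'D_('e_j) (f^~ r) x))).

(* The sign condition on y is part of the problem: y is a bound on the
   residual, and with y of arbitrary sign the changes (y, v) |-> (- y, - v)
   and (y, v) |-> (c y, v / c), c >= 1, would make the cost unbounded below. *)
Definition feasible (R : realType) (n N : nat) (t : 'I_N.+1 -> R)
    (z : 'I_N.+1 -> 'rV[R]_n) (f : 'rV[R]_n -> R -> 'rV[R]_n)
    (x : 'I_N -> R -> 'rV[R]_n) (y : 'I_N -> R -> R)
    (v : 'I_N -> R -> 'rV[R]_n) : Prop :=
  forall i : 'I_N,
    [/\ W1oo_vec (x i), W1oo (y i) & Loo01_vec (v i)] /\
    [/\ ae01 (fun s => has_deriv01 (x i) s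
               (tau t i *: (fstage t f i (x i s) s + y i s *: v i s))),
        x i 0 = z (lnode i) /\ x i 1 = z (rnode i),
        forall s : R, 0 <= s <= 1 -> has_deriv01 (y i) s 0,
        forall s : R, 0 <= s <= 1 -> 0 <= y i s &
        forall j, ae01 (fun s => `|v i s 0 j| <= 1)].

Definition cost (R : realType) (N : nat) (t : 'I_N.+1 -> R)
    (y : 'I_N -> R -> R) : R :=
  \sum_(i < N) tau t i * \int[@lebesgue_measure R]_(s in `[0, 1]) y i s.

Definition solves_PLinfd (R : realType) (n N : nat) (t : 'I_N.+1 -> R)
    (z : 'I_N.+1 -> 'rV[R]_n) (f : 'rV[R]_n -> R -> 'rV[R]_n)
    (x : 'I_N -> R -> 'rV[R]_n) (y : 'I_N -> R -> R)
    (v : 'I_N -> R -> 'rV[R]_n) : Prop :=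
  feasible t z f x y v /\
  forall x' y' v', feasible t z f x' y' v' -> cost t y <= cost t y'.

Definition hamiltonian (R : realType) (n N : nat) (t : 'I_N.+1 -> R)
    (f : 'rV[R]_n -> R -> 'rV[R]_n) (i : 'I_N) (x : 'rV[R]_n) (y lambda0 : R)
    (lambda : 'rV[R]_n) (mu : R) (v : 'rV[R]_n) (s : R) : R :=
  tau t i * (lambda0 * y
             + \sum_(j < n) lambda 0 j * (fstage t f i x s + y *: v) 0 j
             + mu * 0).

Record multipliers (R : realType) (n N : nat) (t : 'I_N.+1 -> R)
    (f : 'rV[R]_n -> R -> 'rV[R]_n)
    (x : 'I_N -> R -> 'rV[R]_n) (y : 'I_N -> R -> R)
    (v : 'I_N -> R -> 'rV[R]_n)
    (lambda0 : R) (lambda : 'I_N -> R -> 'rV[R]_n) (mu : 'I_N -> R -> R) :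
    Prop := Multipliers {
  mult_ge0 : 0 <= lambda0;
  mult_lambda_W1oo : forall i, W1oo_vec (lambda i);
  mult_mu_W1oo : forall i, W1oo (mu i);
  mult_neq0 : forall i (s : R), 0 <= s <= 1 -> (lambda0, lambda i s, mu i s) <> 0;
  mult_lambda_deriv : forall i j, ae01 (fun s =>
    has_deriv01 (fun r => lambda i r 0 j) s
      (- 'D_('e_j) (fun x' : 'rV[R]_n => hamiltonian t f i
             x' (y i s) lambda0 (lambda i s) (mu i s) (v i s) s) (x i s)));
  mult_lambda_jump : exists delta : 'I_N -> 'rV[R]_n,
    forall i i' : 'I_N, i' = i.+1 :> nat ->
    forall j, lambda i' 0 0 j = lambda i 1 0 j + delta i 0 j;
  mult_mu_deriv : forall i, ae01 (fun s =>
    has_deriv01 (mu i) s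
      (- derive1 (fun y' : R => hamiltonian t f i
             (x i s) y' lambda0 (lambda i s) (mu i s) (v i s) s) (y i s)));
  mult_mu_ends : forall i, mu i 0 = 0 /\ mu i 1 = 0;
  mult_argmin : forall i, ae01 (fun s =>
    argmin (fun w => hamiltonian t f i
               (x i s) (y i s) lambda0 (lambda i s) (mu i s) w s)
           (@cube R n) (v i s)) }.

(* Main.v *)
Require Import Defs.
From mathcomp Require Import all_boot all_order all_algebra.
From mathcomp Require Import all_classical all_reals all_analysis.
From mathcomp Require Import ring lra.
Import Order.TTheory GRing.Theory Num.Theory.
Import numFieldNormedType.Exports.
Local Open Scope classical_set_scope.
Local Open Scope ring_scope.

(* If [lambda0 = 0], minimality of [v] gives [mu' = tau * |lambda|_1 >= 0], so
   [mu], which vanishes at both ends, is identically [0]; hence [lambda = 0]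
   almost everywhere, against the nontriviality of the multipliers.  That an
   absolutely continuous function with nonnegative derivative almost everywhere
   is nondecreasing is proved without integration: the exceptional null set is
   covered by an open set of small measure, on which the function varies little,
   and elsewhere the derivative controls the drop; continuous induction glues
   the local estimates. *)

(** * Derivatives relative to [[0, 1]] and almost-everywhere statements *)

Lemma has_deriv01_ge0_near {R : realType} {u : R -> R} {s d e : R} :
  has_deriv01 u s d -> 0 <= d -> 0 < e ->
  exists2 r : R, 0 < r & forall q, 0 <= q <= 1 -> q != s -> `|q - s| < r ->
    - e < (q - s)^-1 * (u q - u s).
Proof.
move=> du d0 e0.
have ed : - e < d by lra.
have := cvgr_gt d du _ ed; rewrite !near_withinE -filter_from_ballE.
case=> r /= r0 H.
exists r => // q q01 qs qr; apply: H => //.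
by rewrite /ball /= distrC.
Qed.

(** Near an interior point the restriction to [[0, 1]] is vacuous, so the filter is the usual
    punctured one and limits along it are unique. *)
Lemma has_deriv01_unique {R : realType} {u : R -> R} {s d d' : R} :
  0 < s < 1 -> has_deriv01 u s d -> has_deriv01 u s d' -> d = d'.
Proof.
move=> s01.
suff wE : within `[0, 1] s^' = s^'.
  by rewrite /has_deriv01 wE => du du'; exact: cvg_unique du du'.
rewrite eqEsubset; split => A; rewrite /within /=.
- have i01 : \forall r \near s^', r \in `]0, 1[.
    by apply: nbhs_dnbhs; apply: near_in_itvoo; rewrite in_itv.
  move=> H; near=> r; have /subset_itv_oo_cc r01: r \in `]0, 1[ by near: r.
  by move: r01; rewrite -/(`[0,1]%classic r); near: r.
- by move=> H; near=> r => _; near: r.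
Unshelve. all: by end_near. Qed.

(** The open interval has measure 1, hence is not negligible; an interior witness is what uniqueness
    of the derivative requires. *)
Lemma ae01_witness {R : realType} {P : R -> Prop} :
  ae01 P -> exists2 s : R, 0 < s < 1 & P s.
Proof.
move=> aeP; apply: contrapT => nP.
have : (@lebesgue_measure R).-negligible `]0, 1[%classic.
  apply: negligibleS aeP => s /=; rewrite in_itv /= => s01 H.
  apply: nP; exists s => //; apply: H.
  by case/andP: s01 => s0 s1; rewrite !ltW.
move=> neg01; have m0 : @lebesgue_measure R `]0, 1[%classic = 0%E.
  by apply: measure_negligible => //; exact: measurable_itv.
have := lebesgue_measure_itv `]0 : R, 1[; rewrite m0 /= lte_fin ltr01 sube0.
by move/esym/eqP; rewrite onee_eq0.
Qed.

Lemma ae01W {R : realType} {P Q : R -> Prop} :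
  (forall s, 0 <= s <= 1 -> P s -> Q s) -> ae01 P -> ae01 Q.
Proof.
move=> PQ; apply: negligibleS => s /= nQ Ps; apply: nQ => s01.
by apply: PQ => //; exact: Ps.
Qed.

Lemma ae01_and {R : realType} {P Q : R -> Prop} :
  ae01 P -> ae01 Q -> ae01 (fun s => P s /\ Q s).
Proof.
move=> aeP aeQ; apply: negligibleS (negligibleU aeP aeQ) => s /= nPQ.
by rewrite -not_andP => -[Ps Qs]; apply: nPQ => s01; split; auto.
Qed.

(** * Monotonicity from an almost everywhere nonnegative derivative *)

Lemma lebesgue_measure_trivIset_itv {R : realType} (m : nat) (a b : 'I_m -> R)
    (U : set R) :
  open U -> (forall k, a k <= b k) -> (forall k, `]a k, b k[ `<=` U) ->
  trivIset setT (fun k => `]a k, b k[%classic) ->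
  ((\sum_k (b k - a k))%:E <= @lebesgue_measure R U)%E.
Proof.
move=> oU ab abU tab.
set F := fun k => `]a k, b k[%classic : set (measurableTypeR R).
have mF k : measurable (F k) by exact: measurable_itv.
have mUF : measurable (\big[setU/set0]_k F k) by exact: bigsetU_measurable.
have -> : (\sum_k (b k - a k))%:E = lebesgue_measure (\big[setU/set0]_k F k).
  rewrite measure_semi_additive_ord // -sumEFin; apply: eq_bigr => k _.
  apply/esym; apply: (etrans (lebesgue_measure_itv `]a k, b k[)).
  (* The length formula distinguishes [a k < b k]; a degenerate interval is empty and contributes
     0. *)
  rewrite /= lte_fin; have := ab k.
  by rewrite le_eqVlt => /predU1P[->|->]//; rewrite ltxx subrr.
apply: le_measure; rewrite ?inE //.
  exact: measurable_realfun.open_measurable.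
apply: (big_ind (fun A : set R => A `<=` U)) => [r []||k _].
- by move=> A B AU BU r [/AU|/BU].
- exact: abU.
Qed.

(** Let [c] be the supremum of the points where [P] holds: the local step with [t = c] puts [c] in
    the set, and with [s = c] it passes beyond [c] unless [c = q]. Only pairs straddling [c] are
    needed, which suits a derivative at [c]. *)
Lemma continuous_induction {R : realType} (P : R -> Prop) (p q : R) :
  p <= q -> P p ->
  (forall c, p <= c <= q -> exists2 r : R, 0 < r & forall s t,
     p <= s <= c -> c <= t <= q -> c - r < s -> t < c + r -> P s -> P t) ->
  P q.
Proof.
move=> pq Pp H.
pose S := [set s | p <= s <= q /\ P s].
have Sp : S p by split => //; rewrite lexx.
have ubS : ubound S q by move=> s [/andP[]].
have hasS : has_sup S by split; [exists p | exists q].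
set c := sup S.
have pc : p <= c by apply: ub_le_sup => //; exists q.
have cq : c <= q by apply: ge_sup => //; exists p.
have [|r r0 {}H] := H c; first by rewrite pc.
have Pc : P c.
  have [s [/andP[ps sq] Ps] cs] := sup_adherent r0 hasS.
  have sc : s <= c by apply: ub_le_sup; [exists q | split; rewrite ?ps].
  by apply: (H s c) => //; rewrite ?ps ?lexx ?cq // ltrDl.
suff -> : q = c by [].
apply/eqP; rewrite eq_le cq andbT leNgt; apply/negP => cltq.
pose t := Num.min q (c + r / 2).
have ct : c < t by rewrite lt_min cltq /= ltrDl divr_gt0.
have tq : t <= q by rewrite ge_min lexx.
have tr : t < c + r by rewrite gt_min; apply/orP; right; lra.
have Pt : P t.
  apply: (H c t) => //; first by rewrite pc lexx.
    by rewrite tq ltW.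
  by lra.
have : t <= c.
  apply: ub_le_sup; first by exists q.
  by split => //; rewrite tq andbT (le_trans pc) // ltW.
by rewrite leNgt ct.
Qed.

(* Stands in for a tagged partition of [[p, t]]: only the intervals tagged by
   exceptional points are recorded, the others being absorbed in [e * (t - p)]. *)
Definition drop_covered {R : realType} (u : R -> R) (U : set R) (e p t : R) :
    Prop :=
  exists m (a b : 'I_m -> R),
    [/\ forall k, [/\ p <= a k, a k <= b k & b k <= t],
        forall k, `]a k, b k[ `<=` U,
        trivIset setT (fun k => `]a k, b k[%classic) &
        u p - u t <= e * (t - p) + \sum_k `|u (b k) - u (a k)|].

(** A small drop is absorbed in the linear term; otherwise []s, t[] joins the family at index
    [ord0], disjoint from the earlier intervals since these end by [s]. *)
Lemma drop_covered_step {R : realType} {u : R -> R} {U : set R} {e p s t : R} :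
  p <= s -> s <= t -> 0 <= e -> u s - u t <= e * (t - s) \/ `]s, t[ `<=` U ->
  drop_covered u U e p s -> drop_covered u U e p t.
Proof.
move=> ps st e0 st_small [m [a [b [abk abU tab drop_s]]]].
case: st_small => [drop_st | stU].
  exists m, a, b; split => //.
    by move=> k; have [pa ab bs] := abk k; split => //; exact: le_trans st.
  by rewrite !mulrBr in drop_s drop_st *; lra.
pose a' k := oapp a s (unlift ord0 k); pose b' k := oapp b t (unlift ord0 k).
exists m.+1, a', b'; split.
- rewrite /a' /b' => k; case: (unliftP ord0 k) => [j|] _ //=.
  by have [pa ab bs] := abk j; split => //; exact: le_trans st.
- by rewrite /a' /b' => k; case: (unliftP ord0 k) => [j|] _ //=.
- have disj j x : x \in `]a j, b j[ -> x \in `]s, t[ -> False.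
    rewrite !in_itv /= => /andP[_ xb] /andP[sx _].
    by have [_ _ bs] := abk j; lra.
  move=> i j _ _; rewrite /a' /b'.
  case: (unliftP ord0 i) => [i' ->|->];
    case: (unliftP ord0 j) => [j' ->|->] //=.
  + by move=> /(tab i' j' I I) ->.
  + by case=> x [/= xi xs]; case: (disj _ _ xi xs).
  + by case=> x [/= xs xj]; case: (disj _ _ xj xs).
- rewrite big_ord_recl /a' /b' unlift_none /=.
  under eq_bigr => k _ do rewrite liftK /=.
  have : u s - u t <= `|u t - u s| by rewrite distrC ler_norm.
  have : 0 <= e * (t - s) by rewrite mulr_ge0 // subr_ge0.
  by rewrite !mulrBr in drop_s *; lra.
Qed.

Lemma abs_cont01_nondecreasing {R : realType} (u : R -> R) :
  abs_cont01 u -> ae01 (fun s => exists2 d, 0 <= d & has_deriv01 u s d) ->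
  forall p q, 0 <= p -> p <= q -> q <= 1 -> u p <= u q.
Proof.
move=> acu aeu p q p0 pq q1; rewrite -subr_le0.
apply/ler_addgt0Pl => e e0; rewrite addr0.
(* One half of [e] pays for the linear term, as [q - p <= 1], the other for the variation on the
   exceptional intervals. *)
have e20 : 0 < e / 2 by rewrite divr_gt0.
have [r r0 acr] := acu _ e20.
set E := [set s | ~ (0 <= s <= 1 -> exists2 d, 0 <= d & has_deriv01 u s d)].
have [U [oU EU Ur]] : exists U : set R,
    [/\ open U, E `<=` U & (lebesgue_measure U < r%:E)%E].
  (* Outer regularity gives a non-strict bound, so [r / 2] is used to stay strictly below [r]. *)
  have r20 : 0 < r / 2 by rewrite divr_gt0.
  have [U [oU EU Ur]] := outer_measure_open_le E r20.
  exists U; split => //; apply: le_lt_trans Ur _.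
  by rewrite (negligible_outer_measure E).1 // add0e lte_fin; lra.
have [m [a [b [abk abU tab drop]]]] : drop_covered u U (e / 2) p q.
  apply: (@continuous_induction _ _ p q) => //.
    exists 0%N, (fun=> 0), (fun=> 0); split; try by case.
    by rewrite big_ord0 !subrr mulr0 addr0.
  move=> c /andP[pc cq].
  have [Ec|nEc] := pselect (E c).
    have /nbhs_ballP[d /= d0 dU] : nbhs c U.
      by apply: open_nbhs_nbhs; split; auto.
    exists d => // s t /andP[ps sc] /andP[ct tq] cs tc.
    apply: (drop_covered_step ps (le_trans sc ct) (ltW e20)); right => x /=.
    rewrite in_itv /= => /andP[sx xt]; apply: dU.
    by rewrite /ball /= ltr_norml; apply/andP; split; lra.
  have [|d d0 du] := contrapT nEc; first by apply/andP; split; lra.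
  have [d' d'0 H] := has_deriv01_ge0_near du d0 e20.
  exists d' => // s t /andP[ps sc] /andP[ct tq] cs tc.
  apply: (drop_covered_step ps (le_trans sc ct) (ltW e20)); left.
  (* The quotient at [c] compares [s] and [t] with [c] separately and excludes [c] itself; left of
     [c] its denominator is negative. *)
  have ucs : u s - u c <= e / 2 * (c - s).
    have [->|nsc] := eqVneq s c; first by rewrite !subrr mulr0.
    have sc0 : s - c < 0 by rewrite subr_lt0 lt_neqAle nsc.
    have := H s; rewrite ltr_norml ltr_ndivlMl // => /(_ _ nsc _)/ltW.
    rewrite -(opprB c s) mulrNN (mulrC (c - s)).
    by apply; apply/andP; split; lra.
  have uct : u c - u t <= e / 2 * (t - c).
    have [->|ntc] := eqVneq t c; first by rewrite !subrr mulr0.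
    have tc0 : 0 < t - c by rewrite subr_gt0 lt_neqAle eq_sym ntc.
    have := H t; rewrite ltr_norml ltr_pdivlMl // => /(_ _ ntc _)/ltW h.
    rewrite -lerN2 opprB mulrC -mulrN.
    by apply: h; apply/andP; split; lra.
  by rewrite !mulrBr in ucs uct *; lra.
have : \sum_k `|u (b k) - u (a k)| < e / 2.
  apply: acr => //.
    by move=> k; have [pa ab bq] := abk k; do ?split; lra.
  rewrite -lte_fin; apply: le_lt_trans Ur.
  by apply: lebesgue_measure_trivIset_itv => // k; have [] := abk k.
have : e / 2 * (q - p) <= e / 2 by rewrite ger_pMr //; lra.
by lra.
Qed.

(** * Rescaling of the multipliers *)

Lemma has_deriv01Z {R : realType} {V : normedModType R} (c : R) {u : R -> V}
    {s : R} {d : V} :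
  has_deriv01 u s d -> has_deriv01 (fun r => c *: u r) s (c *: d).
Proof.
rewrite /has_deriv01 => du.
under eq_fun do rewrite -scalerBr scalerA mulrC -scalerA.
exact: cvgZr.
Qed.

Lemma abs_cont01Z {R : realType} (c : R) {u : R -> R} :
  abs_cont01 u -> abs_cont01 (fun s => c * u s).
Proof.
(* Adding 1 keeps the divisor positive when [c = 0]. *)
move=> acu e e0; have c0 : 0 < `|c| + 1 by rewrite ltr_wpDl.
have [d d0 acd] := acu _ (divr_gt0 e0 c0).
exists d => // m a b ab tab /(acd m a b ab tab).
rewrite ltr_pdivlMr //; apply: le_lt_trans.
rewrite mulr_suml; apply: ler_sum => k _.
by rewrite -mulrBr normrM mulrC ler_wpM2l // lerDl.
Qed.

Lemma Loo01Z {R : realType} (c : R) {g : R -> R} :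
  Loo01 g -> Loo01 (fun s => c * g s).
Proof.
rewrite /Loo01 => gLoo.
have -> : (fun s => c * g s) \_ `[0, 1] = c *: (g \_ `[0, 1]) :> (R -> R).
  apply/funext => s; rewrite /patch [RHS]/GRing.scale /=.
  by case: ifP => _ //; rewrite /GRing.scale /= mulr0.
have [S0 SD] := Lfun_submod_closed (@lebesgue_measure R) (leey 1).
have := SD c _ _ gLoo S0; rewrite addr0; apply.
Qed.

Lemma W1ooZ {R : realType} (c : R) {u : R -> R} :
  W1oo u -> W1oo (fun s => c * u s).
Proof.
move=> [acu [g gLoo du]]; split; first exact: abs_cont01Z.
exists (fun s => c * g s); first exact: Loo01Z.
by apply: ae01W du => s _; exact: has_deriv01Z.
Qed.

(* If [g] is not derivable, both sides are the junk value [0]. *)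
Lemma deriveZ_neq0 {R : realType} {V : normedModType R} (g : V -> R) (c : R)
    (a w : V) :
  c != 0 -> 'D_w (fun x => c * g x) a = c * 'D_w g a.
Proof.
move=> c0; have [dg|ndg] := pselect (derivable g a w); first exact: deriveZ.
have ndcg : ~ derivable (fun x => c * g x) a w.
  move=> /(@derivableZ _ _ _ _ c^-1) dcg; apply: ndg.
  suff -> : g = (fun x => c^-1 *: (c * g x : R)) by exact: dcg.
  by apply/funext => x; rewrite /GRing.scale /= mulKf.
by rewrite /derive (dvgP ndg) (dvgP ndcg); exact: esym (mulr0 c).
Qed.

Section Stage.
Context {R : realType} {n N : nat} {t : 'I_N.+1 -> R}
  {f : 'rV[R]_n -> R -> 'rV[R]_n}.

Lemma hamiltonianZ (i : 'I_N) (c : R) x y l0 l mu w s :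
  hamiltonian t f i x y (c * l0) (c *: l) (c * mu) w s =
  c * hamiltonian t f i x y l0 l mu w s.
Proof.
rewrite /hamiltonian [RHS]mulrCA; congr (_ * _).
rewrite !mulr0 !addr0 mulrDr mulr_sumr mulrA; congr (_ + _).
by apply: eq_bigr => j _; rewrite mxE mulrA.
Qed.

(** The Hamiltonian is homogeneous in [(l0, l, mu)], so every condition scales; [0 < c] preserves
    the sign of [l0], nontriviality and the minimizers. *)
Lemma multipliersZ (x : 'I_N -> R -> 'rV[R]_n) (y : 'I_N -> R -> R)
    (v : 'I_N -> R -> 'rV[R]_n) (l0 c : R) (l : 'I_N -> R -> 'rV[R]_n)
    (mu : 'I_N -> R -> R) :
  0 < c -> multipliers t f x y v l0 l mu ->
  multipliers t f x y v (c * l0) (fun i s => c *: l i s)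
    (fun i s => c * mu i s).
Proof.
move=> c0 [l0_ge0 lW muW neq0 dl [delta jump] dmu muE vmin].
have cN0 : c != 0 by rewrite gt_eqF.
split.
- by rewrite mulr_ge0 // ltW.
- move=> i j; have := W1ooZ c (lW i j).
  by under [X in _ -> W1oo X]eq_fun do rewrite mxE.
- by move=> i; exact: W1ooZ.
- move=> i s s01 [/eqP]; rewrite mulf_eq0 (negPf cN0) /= => /eqP l00.
  move/eqP; rewrite scaler_eq0 (negPf cN0) /= => /eqP li0.
  move/eqP; rewrite mulf_eq0 (negPf cN0) /= => /eqP mui0.
  by apply: (neq0 i s s01); rewrite l00 li0 mui0.
- move=> i j; apply: ae01W (dl i j) => s _ /(has_deriv01Z c).
  under [X in _ -> has_deriv01 _ _ (- 'D_('e_j) X _)]eq_fun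
    do rewrite hamiltonianZ.
  rewrite (deriveZ_neq0 _ _ _ _ cN0) -mulrN.
  by under [X in _ -> has_deriv01 X _ _]eq_fun do rewrite mxE.
- exists (fun i => c *: delta i) => i i' ii' j.
  by rewrite !mxE (jump _ _ ii') mulrDr.
- move=> i; apply: ae01W (dmu i) => s _ /(has_deriv01Z c).
  under [X in _ -> has_deriv01 _ _ (- derive1 X _)]eq_fun
    do rewrite hamiltonianZ.
  by rewrite !derive1E (deriveZ_neq0 _ _ _ _ cN0) -mulrN.
- by move=> i; have [-> ->] := muE i; rewrite mulr0.
- move=> i; apply: ae01W (vmin i) => s _ [vs vmin_s]; split => // w cw.
  by rewrite !hamiltonianZ ler_pM2l //; exact: vmin_s.
Qed.

(** * The Hamiltonian as a function of [y] and of the control *)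

Lemma derive1_hamiltonian_y (i : 'I_N) x y l0 l mu w s :
  derive1 (fun y' => hamiltonian t f i x y' l0 l mu w s) y =
  tau t i * (l0 + \sum_j l 0 j * w 0 j).
Proof.
pose A := \sum_j l 0 j * w 0 j.
pose B := \sum_j l 0 j * fstage t f i x s 0 j.
(* The Hamiltonian is affine in [y'], so the derivative is its slope. *)
have -> : (fun y' => hamiltonian t f i x y' l0 l mu w s) =
    (fun y' => tau t i * (l0 + A) * y' + tau t i * B).
  apply/funext => y'; rewrite /hamiltonian mulr0 addr0.
  have -> : \sum_j l 0 j * (fstage t f i x s + y' *: w) 0 j = B + y' * A.
    rewrite mulr_sumr -big_split /=; apply: eq_bigr => j _.
    by rewrite !mxE; ring.
  by ring.
rewrite derive1E; apply: derive_val; apply: is_derive_eq.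
by rewrite addr0; exact: mulr1.
Qed.

(** Compare [w] with the point [- sg l] of the cube, where the linear form equals minus the l1 norm
    of [l]. Positivity of [y] and [tau] allows both factors to be cancelled. *)
Lemma argmin_hamiltonian {i : 'I_N} {x y l0} {l : 'rV[R]_n} {mu w s} :
  0 < tau t i -> 0 < y ->
  argmin (fun w' => hamiltonian t f i x y l0 l mu w' s) (@cube R n) w ->
  \sum_j l 0 j * w 0 j <= - \sum_j `|l 0 j|.
Proof.
move=> tau0 y0 [_ /(_ (\row_j - Num.sg (l 0 j)))].
have sg_cube : cube (\row_j - Num.sg (l 0 j)).
  by move=> j; rewrite mxE normrN normr_sg lern1 leq_b1.
move/(_ sg_cube); rewrite /hamiltonian ler_pM2l // !mulr0 !addr0 lerD2l.
under eq_bigr do rewrite mxE mulrDr mxE mulrCA.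
under [leRHS]eq_bigr do rewrite mxE mulrDr mxE mulrCA.
rewrite !big_split lerD2l -!mulr_sumr ler_pM2l //.
under [leRHS]eq_bigr do rewrite mxE mulrN mulrC -normrEsg.
by rewrite sumrN.
Qed.
End Stage.

(** * Exclusion of the abnormal case and normalization *)

Lemma has_deriv01_0 {R : realType} {u : R -> R} {s : R} :
  (forall r, 0 <= r <= 1 -> u r = 0) -> 0 <= s <= 1 -> has_deriv01 u s 0.
Proof.
move=> u0 s01; apply: cvg_near_cst; rewrite near_withinE.
by near=> r => r01; rewrite !u0 // subrr scaler0.
Unshelve. all: by end_near. Qed.

Lemma abnormal_absurd {R : realType} {n N : nat} {t : 'I_N.+1 -> R}
    {f : 'rV[R]_n -> R -> 'rV[R]_n} {x : 'I_N -> R -> 'rV[R]_n}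
    {y : 'I_N -> R -> R} {v : 'I_N -> R -> 'rV[R]_n}
    {l : 'I_N -> R -> 'rV[R]_n} {mu : 'I_N -> R -> R} (i : 'I_N) :
  0 < tau t i -> (forall s, 0 <= s <= 1 -> 0 < y i s) ->
  ~ multipliers t f x y v 0 l mu.
Proof.
move=> tau0 y0 [_ _ muW neq0 _ _ dmu muE vmin].
pose dmu_s s := - (tau t i * \sum_j l i s 0 j * v i s 0 j).
have dmuE : ae01 (fun s => has_deriv01 (mu i) s (dmu_s s)).
  apply: ae01W (dmu i) => s _.
  by rewrite derive1_hamiltonian_y add0r.
have l1_le : ae01 (fun s => tau t i * \sum_j `|l i s 0 j| <= dmu_s s).
  apply: ae01W (vmin i) => s s01 /(argmin_hamiltonian tau0 (y0 s s01)) lv.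
  by rewrite /dmu_s -mulrN ler_pM2l // lerNr.
have l1_ge0 s : 0 <= tau t i * \sum_j `|l i s 0 j|.
  by rewrite mulr_ge0 ?sumr_ge0 // ltW.
have mu_mono : forall p q, 0 <= p -> p <= q -> q <= 1 -> mu i p <= mu i q.
  apply: abs_cont01_nondecreasing; first by have [] := muW i.
  apply: ae01W (ae01_and dmuE l1_le) => s _ [dmus l1s].
  by exists (dmu_s s) => //; exact: le_trans l1s.
have [mu0 mu1] := muE i.
have muN s : 0 <= s <= 1 -> mu i s = 0.
  (* Monotonicity squeezes [mu i s] between the zero end values. *)
  move=> /andP[s0 s1]; apply/eqP; rewrite eq_le.
  by rewrite -{1}mu1 -{1}mu0 !mu_mono.
(* Nontriviality holds at every point, so one interior [s] suffices: there the derivative of [mu] is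
   0 and dominates [tau] times the l1 norm of [l i s]. *)
have [s s01 [dmus l1s]] := ae01_witness (ae01_and dmuE l1_le).
have s01' : 0 <= s <= 1 by case/andP: s01 => s0 s1; rewrite !ltW.
apply: (neq0 i s s01'); rewrite muN //.
suff -> : l i s = 0 by [].
have l1_0 : \sum_j `|l i s 0 j| <= 0.
  rewrite -(pmulr_rle0 _ tau0); apply: le_trans l1s _.
  by rewrite (has_deriv01_unique s01 dmus (has_deriv01_0 muN s01')).
apply/rowP => j; rewrite mxE; apply/eqP; rewrite -normr_le0.
apply: le_trans l1_0; rewrite (bigD1 j) //= lerDl.
by apply: sumr_ge0.
Qed.

Theorem lemma2 (R : realType) (n N : nat) (N_gt0 : (0 < N)%N)
    (t : 'I_N.+1 -> R) (ht : forall i : 'I_N, t (lnode i) < t (rnode i))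
    (z : 'I_N.+1 -> 'rV[R]_n)
    (hz : forall i : 'I_N, z (rnode i) <> z (lnode i))
    (f : 'rV[R]_n -> R -> 'rV[R]_n)
    (hf : continuous_C1_fst (t ord0) (t ord_max) f)
    (x : 'I_N -> R -> 'rV[R]_n) (y : 'I_N -> R -> R)
    (v : 'I_N -> R -> 'rV[R]_n)
    (hsol : solves_PLinfd t z f x y v)
    (alpha : 'I_N -> R) (halpha : forall i, 0 < alpha i)
    (hy : forall i (s : R), 0 <= s <= 1 -> y i s = alpha i)
    (lambda0 : R) (lambda : 'I_N -> R -> 'rV[R]_n) (mu : 'I_N -> R -> R)
    (hmult : multipliers t f x y v lambda0 lambda mu) :
  0 < lambda0 /\
  multipliers t f x y v 1 (fun i s => lambda0^-1 *: lambda i s)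
    (fun i s => lambda0^-1 * mu i s).
Proof.
have lambda0_gt0 : 0 < lambda0.
  rewrite lt_neqAle (mult_ge0 hmult) andbT eq_sym; apply/eqP => lambda00.
  (* The contradiction arises within a single stage; the first one exists because [0 < N]. *)
  move: hmult; rewrite lambda00; apply: (abnormal_absurd (Ordinal N_gt0)).
    by rewrite subr_gt0.
  by move=> s s01; rewrite hy.
(* Writing 1 as [lambda0^-1 * lambda0] exhibits the new multipliers as a positive rescaling of the
   old. *)
split => //; rewrite -(mulVf (lt0r_neq0 lambda0_gt0)).
by apply: multipliersZ; rewrite ?invr_gt0.
Qed.
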